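(* There exist $E$-systems which are neither mean sensitive nor mean equicontinuous.
   Context: A t.d.s. (topological dynamical system) is a pair $(X,T)$ where $X$ is a non-empty compact metric space with metric $d$ and $T\colon X\to X$ is continuous; $\mathbb{N}$ denotes the positive integers. $(X,T)$ is transitive if for all non-empty open $U,V\subset X$ there is $n\in\mathbb{N}$ with $T^nU\cap V\neq\emptyset$. A t.d.s. is an $E$-system if it is transitive and there exists a $T$-invariant Borel probability measure with full support. $(X,T)$ is mean equicontinuous if for every $x\in X$ and every $\varepsilon>0$ there is $\delta>0$ such that for every $y\in X$ with $d(x,y)<\delta$ we have $\limsup_{n\to\infty}\frac1n\sum_{i=0}^{n-1}d(T^ix,T^iy)<\varepsilon$. $(X,T)$ is mean sensitive if there is $\delta>0$ such that for every non-empty open $U\subset X$ there are $x,y\in U$ with $\limsup_{n\to\infty}\frac1n\sum_{i=0}^{n-1}d(T^ix,T^iy)>\delta$. *)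

(* Defs.v *)
From HB Require Import structures.
From mathcomp Require Import all_boot all_order all_algebra.
From mathcomp Require Import all_classical all_reals all_analysis.

Set Implicit Arguments.
Unset Strict Implicit.
Unset Printing Implicit Defensive.

Import Order.TTheory GRing.Theory Num.Theory.
Import numFieldNormedType.Exports.

Local Open Scope classical_set_scope.
Local Open Scope ring_scope.

(* The point witnesses non-emptiness; the library's measurable types are
   pointed as well. *)
#[short(type="pmetricType")]
HB.structure Definition PointedMetric (K : numDomainType) :=
  { M of Metric K M & Pointed M }.

Section dynamics.
Context {R : realType} {X : pmetricType R}.
Implicit Types (T : X -> X) (x y : X) (U V : set X).

Definition tds T := compact [set: X] /\ continuous T.

Definition transitive_system T :=
  forall U V, open U -> U !=set0 -> open V -> V !=set0 ->
    exists n, (0 < n)%N /\ (iter n T @` U) `&` V !=set0.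

Definition borel := g_sigma_algebraType (@open X).

Definition invariant_measure T (mu : probability borel R) :=
  forall A : set borel, measurable A -> mu (T @^-1` A) = mu A.

Definition measure_support (mu : probability borel R) : set X :=
  [set x | forall U, open U -> U x -> (0 < mu U)%E].

Definition full_support (mu : probability borel R) :=
  measure_support mu = [set: X].

Definition E_system T :=
  [/\ tds T, transitive_system T &
      exists mu : probability borel R, invariant_measure T mu /\ full_support mu].

(* The limsup is taken in the extended reals; the n = 0 term, which is 0,
   does not affect it. *)
Definition mean_dist T x y : \bar R :=
  limn_esup (fun n =>
    (n%:R^-1 * \sum_(i < n) mdist (iter i T x) (iter i T y))%:E).

Definition mean_equicontinuous T :=
  forall x (e : R), 0 < e -> exists2 delta : R, 0 < delta &
    forall y, mdist x y < delta -> (mean_dist T x y < e%:E)%E.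

Definition mean_sensitive T :=
  exists2 delta : R, 0 < delta &
    forall U, open U -> U !=set0 ->
      exists x y, [/\ U x, U y & (delta%:E < mean_dist T x y)%E].

End dynamics.

(* Main.v *)
Require Import Defs.
From HB Require Import structures.
From mathcomp Require Import all_boot all_order all_algebra.
From mathcomp Require Import all_classical all_reals all_analysis.
From mathcomp Require Import ring lra zify.

(** The system is the shift on the space X of sequences y with values in [0, 1]
such that, for all i and n,
<<
  y i + y (i + 1) + ... + y (i + n - 1) <= 2 * n * y i,
>>
so that the value at any time bounds, up to the factor 2, all averages of the
values from that time on.  These constraints are closed, linear and shift
invariant, hence X is compact, convex and invariant.

Not mean sensitive.  The constraint for n = 2 gives y (i + 1) <= 3 * y i, so for
the metric sup_m |x m - y m| / 3 ^ m the distance of y to the zero sequence is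
y 0, and d(x, y) <= x 0 + y 0 ([dist_le_head]).  Averaging along the orbits,
the mean distance of x and y is at most 2 (x 0 + y 0): it is arbitrarily small
on the open sets where y 0 is small ([mean_dist_le_head]).

Not mean equicontinuous.  The constant sequence 1 is a limit of the sequences
1 ... 1 0 0 0 ..., which end up at the fixed point 0, at distance 1.

Transitive, with dense periodic points.  A prefix of y in X may be followed by
any b in X whose first value is a lower bound of the prefix ([tame_glue]); in
the same way a word whose first value is its minimum may be repeated
periodically ([tame_periodic]).  It remains to be able to reach a given word of
length n from arbitrarily small values: the descent in X is free, but the
ascent is slow.  Giving the value sqrt (n / t) to the time at distance t from
the end of the word works, because the sum of 1 / sqrt s for 0 < s <= t is at
most 2 * t / sqrt t ([ladder]).

Invariant measure.  Uniform measures on countably many periodic orbits, mixed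
with positive weights, form an invariant probability measure, whose support is
full as soon as these orbits are dense ([periodic_full_support_measure]). *)

Set Implicit Arguments.
Unset Strict Implicit.
Unset Printing Implicit Defensive.

Import Order.TTheory GRing.Theory Num.Theory.
Import numFieldNormedType.Exports.

Local Open Scope classical_set_scope.
Local Open Scope ring_scope.

(** * Sequences whose later averages are bounded by the current value *)

Section tame_sequences.
Context {R : realType}.
Implicit Types (y b : nat -> R) (n m i : nat).

Definition tame y :=
  (forall i, 0 <= y i <= 1) /\
  (forall i n, \sum_(j < n) y (i + j)%N <= 2 * n%:R * y i).

Lemma tame_cst (c : R) : 0 <= c <= 1 -> tame (fun=> c).
Proof.
move=> c01; split=> // i n; rewrite sumr_const card_ord -[c *+ n]mulr_natl.
have /andP[c0 _] := c01; rewrite ler_wpM2r//.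
by rewrite ler_peMl ?ler0n ?ler1n.
Qed.

Lemma tame_shift y m : tame y -> tame (fun i => y (m + i)%N).
Proof.
move=> [y01 ys]; split=> [i|i n]; first exact: y01.
by under eq_bigr do rewrite addnA; exact: ys.
Qed.

Lemma tame_growth y i : tame y -> y i <= 3 ^+ i * y 0%N.
Proof.
move=> [y01 ys]; elim: i => [|i IH]; first by rewrite expr0 mul1r.
have := ys i 2; rewrite !big_ord_recr big_ord0/= add0r addn0 addn1.
rewrite exprS -mulrA => ?; lra.
Qed.

(** A convex combination with the constant sequence 1; it makes the values
bounded away from 0, which leaves room for gluing. *)
Lemma tame_contract y (h : R) : 0 <= h <= 1 -> tame y ->
  tame (fun i => (1 - h) * y i + h).
Proof.
move=> h01 [y01 ys]; split=> [i|i n].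
  by have := y01 i => ?; apply/andP; split; nra.
rewrite big_split/= -mulr_sumr sumr_const card_ord -[h *+ n]mulr_natl.
have := ys i n => ysn; have n0 : 0 <= n%:R :> R by rewrite ler0n.
have : (1 - h) * (\sum_(j < n) y (i + j)%N) <= (1 - h) * (2 * n%:R * y i).
  by rewrite ler_wpM2l// subr_ge0; case/andP: h01.
have : 0 <= n%:R * h by rewrite mulr_ge0//; case/andP: h01.
lra.
Qed.

Definition glue n y b i := if (i < n)%N then y i else b (i - n)%N.

(** Within the prefix the constraint is that of y; past the prefix each new
term costs on average at most 2 b 0, which every value of the prefix affords. *)
Lemma tame_glue n y b : tame y -> tame b ->
  (forall i, (i < n)%N -> b 0%N <= y i) -> tame (glue n y b).
Proof.
move=> [y01 ys] [b01 bs] by0; split=> [i|i N]; rewrite /glue.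
  by case: ifP.
case: ltnP => [lt_in|le_ni]; last first.
  rewrite -[leRHS]/(2 * N%:R * b (i - n)%N).
  apply: le_trans (bs _ _); apply: ler_sum => j _.
  by rewrite ltnNge (leq_trans le_ni) ?leq_addr//= addnBAC.
have [leN|ltN] := leqP N (n - i).
  apply: le_trans (ys _ _); apply: ler_sum => j _.
  by rewrite ifT//; have := ltn_ord j; lia.
have -> : N = ((n - i) + (N - (n - i)))%N by lia.
move: (N - _)%N => s; rewrite big_split_ord/= natrD mulrDr mulrDl lerD//.
  apply: le_trans (ys _ _); apply: ler_sum => j _.
  by rewrite ifT//; have := ltn_ord j; lia.
apply: le_trans (_ : 2 * s%:R * b 0%N <= _); last first.
  by rewrite ler_wpM2l ?by0// mulr_ge0.
apply: le_trans (bs _ _); apply: ler_sum => j _.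
rewrite ifF; last by lia.
by have -> : (i + (n - i + j) - n = 0 + j)%N by lia.
Qed.

(** Any single constraint on the periodic sequence only sees finitely many
repetitions, which are obtained by iterated gluing in front of 0. *)
Lemma tame_periodic P b : (0 < P)%N -> tame b ->
  (forall i, (i < P)%N -> b 0%N <= b i) -> tame (fun i => b (i %% P)%N).
Proof.
move=> P0 tb bmin.
pose rep k := iter k (glue P b) (fun=> 0).
have rep0 k : rep k 0%N <= b 0%N.
  by case: k => [|k]; rewrite /rep/= ?/glue ?P0//; case: tb => /(_ 0%N)/andP[].
have trep k : tame (rep k).
  elim: k => [|k IH]; first by apply: tame_cst; rewrite lexx ler01.
  by apply: tame_glue => // i iP; exact: le_trans (rep0 _) (bmin _ iP).
have repE k i : (i < k * P)%N -> rep k i = b (i %% P)%N.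
  elim: k i => [//|k IH] i; rewrite mulSn => ik; rewrite /rep/= -/(rep k) /glue.
  case: ltnP => [lt_iP|le_Pi]; first by rewrite modn_small.
  by rewrite IH; [rewrite -[in RHS](subnK le_Pi) modnDr | lia].
split=> [i|i n]; first by case: tb.
have [_ /(_ i n)] := trep (i + n).+1.
have lt m : (m <= i + n)%N -> (m < (i + n).+1 * P)%N.
  move=> mi; apply: (@leq_trans (i + n).+1) => //; exact: leq_pmulr.
rewrite (repE _ i); last by apply: lt; exact: leq_addr.
apply: le_trans; apply: ler_sum => j _; rewrite repE//.
by apply: lt; rewrite leq_add2l ltnW.
Qed.

(** By comparison of 1 / sqrt s with the increment 2 (sqrt s - sqrt (s - 1)).
The bound holds also for N > t: the extra terms are 1 / sqrt 0 = 0. *)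
Lemma sum_inv_sqrt (t N : nat) :
  \sum_(j < N) (Num.sqrt (t - j)%:R)^-1 <= 2 * N%:R * (Num.sqrt t%:R)^-1 :> R.
Proof.
have sqrtS s : (Num.sqrt s%:R)^-1 <=
    2 * (Num.sqrt s%:R - Num.sqrt (s.-1)%:R) :> R.
  case: s => [|s]; first by rewrite sqrtr0 invr0 subrr mulr0.
  have := @sqr_sqrtr R s%:R (ler0n _ _).
  have := @sqr_sqrtr R s.+1%:R (ler0n _ _).
  have : 0 < Num.sqrt s.+1%:R :> R by rewrite sqrtr_gt0.
  have : Num.sqrt s%:R <= Num.sqrt s.+1%:R :> R by rewrite ler_wsqrtr ?ler_nat.
  have := sqrtr_ge0 (s%:R : R); rewrite /= -natr1.
  move: (Num.sqrt (s%:R + 1)) (Num.sqrt _) => u v v0 vu u0 u2 v2.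
  have uV : u * u^-1 = 1 by rewrite divff ?gt_eqF.
  have -> : u^-1 = (u ^+ 2 - v ^+ 2) * u^-1 by rewrite u2 v2 addrC addKr mul1r.
  rewrite ler_pdivrMr//; nra.
have tele : \sum_(j < N) (Num.sqrt (t - j)%:R)^-1 <=
    2 * (Num.sqrt t%:R - Num.sqrt (t - N)%:R) :> R.
  elim: N => [|N IH]; first by rewrite big_ord0 subn0 subrr mulr0.
  rewrite big_ord_recr/=; have := sqrtS (t - N)%N; rewrite subnS; lra.
apply: (le_trans tele); rewrite -mulrA ler_wpM2l//.
have [->|t0] := posnP t; first by rewrite sub0n subrr sqrtr0 invr0 mulr0.
have u0 : 0 < Num.sqrt t%:R :> R by rewrite sqrtr_gt0 ltr0n.
rewrite ler_pdivlMr// mulrBl -expr2 sqr_sqrtr ?ler0n//.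
have : Num.sqrt (t - N)%:R <= Num.sqrt t%:R :> R.
  by rewrite ler_wsqrtr ?ler_nat ?leq_subr.
have := @sqr_sqrtr R (t - N)%:R (ler0n _ _).
have := sqrtr_ge0 ((t - N)%:R : R).
have : t%:R <= (t - N)%:R + N%:R :> R by rewrite -natrD ler_nat; lia.
nra.
Qed.

(** The slow ascent: a tame sequence that starts below h, at its minimum over
the first m + n values, and reads the first n values of y from time m on. *)
Lemma ladder n y (h : R) : (0 < n)%N -> 0 < h -> tame y ->
  (forall i, (i < n)%N -> h <= y i) ->
  exists m b, [/\ tame b, b 0%N <= h,
    (forall i, (i < m + n)%N -> b 0%N <= b i) &
    (forall i, (i < n)%N -> b (m + i)%N = y i)].
Proof.
move=> n0 h0 ty hy.
(* this choice of m gives sqrt (n / (m + n)) <= h *)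
have [m mh] : exists m : nat, n%:R / h ^+ 2 < m%:R.
  by exists (Num.truncn (n%:R / h ^+ 2)).+1; exact: truncnS_gt.
have m0 : (0 < m)%N.
  by rewrite -(ltr_nat R); apply: le_lt_trans mh; rewrite divr_ge0 ?sqr_ge0.
(* the value assigned at distance t from the end of the word; it is 1 at t = n,
   so it dominates the word itself as well *)
pose g t : R := Num.sqrt n%:R * (Num.sqrt t%:R)^-1.
have g_ge0 t : 0 <= g t by rewrite mulr_ge0 ?invr_ge0 ?sqrtr_ge0.
have sn0 : 0 < Num.sqrt n%:R :> R by rewrite sqrtr_gt0 ltr0n.
have g_decr s t : (0 < s)%N -> (s <= t)%N -> g t <= g s.
  move=> s0 st; rewrite ler_pM2l// lef_pV2 ?posrE ?sqrtr_gt0 ?ltr0n//; last lia.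
  by rewrite ler_wsqrtr ?ler_nat.
have gn : g n = 1 by rewrite /g divff ?gt_eqF.
have gh : g (m + n)%N <= h.
  rewrite ler_pdivrMr ?sqrtr_gt0 ?ltr0n ?addn_gt0 ?m0//.
  rewrite -[X in X * _](gtr0_norm h0) -sqrtr_sqr -sqrtrM ?sqr_ge0//.
  rewrite ler_sqrt; last by rewrite mulr_ge0 ?sqr_ge0.
  rewrite mulrC -ler_pdivrMr ?exprn_gt0// (le_trans (ltW mh))//.
  by rewrite ler_nat leq_addr.
pose e := glue n y (fun=> 0).
have te : tame e.
  apply: tame_glue => // [|i _]; first by apply: tame_cst; rewrite lexx ler01.
  by case: ty => /(_ i)/andP[].
pose b := glue m (fun i => g (m + n - i)%N) e.
have b_le i : b i <= g (m + n - i)%N.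
  rewrite /b /glue; case: ltnP => // mi; rewrite /e /glue.
  case: ltnP => // imn.
  apply: (@le_trans _ _ 1); first by case: ty => /(_ (i - m)%N)/andP[].
  by rewrite -gn g_decr//; lia.
have b0 : b 0%N = g (m + n)%N by rewrite /b /glue m0 subn0.
exists m, b; split.
- split=> [i|i N].
    rewrite /b /glue; case: ltnP => im; last by case: te.
    by rewrite g_ge0/= -gn g_decr//; lia.
  have [im|mi] := ltnP i m.
    have -> : b i = g (m + n - i)%N by rewrite /b /glue im.
    rewrite [leRHS]mulrCA.
    apply: le_trans (ler_wpM2l (ltW sn0) (sum_inv_sqrt _ _)).
    by rewrite mulr_sumr; apply: ler_sum => j _; rewrite -subnDA; exact: b_le.
  rewrite -(subnKC mi); move: (i - m)%N => k.
  have bE q : b (m + q)%N = e q by rewrite /b /glue ltnNge leq_addr/= addKn.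
  rewrite bE; apply: le_trans (proj2 te k N); apply: ler_sum => j _.
  by rewrite -addnA bE.
- by rewrite b0.
- move=> i imn; rewrite b0 /b /glue; case: ltnP => im.
    by apply: g_decr; lia.
  rewrite /e /glue ifT; last lia.
  by apply: (le_trans gh); apply: hy; lia.
- by move=> i lt_in; rewrite /b /glue ltnNge leq_addr/= addKn /e /glue lt_in.
Qed.

End tame_sequences.

(** * The compact metric space of tame sequences *)

Record tame_seq (R : realType) := TameSeq {
  seq_of :> nat -> R;
  tame_seqP : tame seq_of
}.

Section tame_space.
Context {R : realType}.
Local Notation X := (tame_seq R).
Implicit Types x y z : X.

HB.instance Definition _ := gen_eqMixin X.
HB.instance Definition _ := gen_choiceMixin X.

Lemma tame_seq_eq x y : x =1 y -> x = y.
Proof.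
case: x y => [x px] [y py] /= /funext xy.
by move: px py; rewrite xy => px py; rewrite (Prop_irrelevance px py).
Qed.

Lemma seq01 x i : 0 <= x i <= 1.
Proof. by case: (tame_seqP x) => /(_ i). Qed.

Lemma seq_ge0 x i : 0 <= x i. Proof. by case/andP: (seq01 x i). Qed.

Lemma seq_le1 x i : x i <= 1. Proof. by case/andP: (seq01 x i). Qed.

(** The weights 3 ^ - m match the growth bound of tame sequences, which makes
the distance to 0 equal to the initial value. *)
Definition wdiff x y m : R := `|x m - y m| / 3 ^+ m.

Definition seq_dist x y : R := sup (range (wdiff x y)).

Lemma wdiff_le1 x y m : wdiff x y m <= 1.
Proof.
rewrite ler_pdivrMr ?exprn_gt0// mul1r; apply: (@le_trans _ _ 1).
  by have := seq01 x m; have := seq01 y m; rewrite ler_norml; lra.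
by rewrite exprn_ege1// ler1n.
Qed.

Lemma wdiff_le_dist x y m : wdiff x y m <= seq_dist x y.
Proof.
apply: ub_le_sup; last by exists m.
by exists 1 => _ [k _ <-]; exact: wdiff_le1.
Qed.

Lemma seq_dist_le x y c : (forall m, wdiff x y m <= c) -> seq_dist x y <= c.
Proof.
move=> le_c; apply: ge_sup; first by exists (wdiff x y 0); exists 0%N.
by move=> _ [k _ <-].
Qed.

Lemma seq_dist_ge0 x y : 0 <= seq_dist x y.
Proof.
by apply: le_trans (wdiff_le_dist x y 0); rewrite /wdiff divr_ge0 ?exprn_ge0.
Qed.

Lemma seq_dist_xx x : seq_dist x x = 0.
Proof.
apply/le_anti; rewrite seq_dist_ge0 andbT; apply: seq_dist_le => m.
by rewrite /wdiff subrr normr0 mul0r.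
Qed.

Lemma seq_dist_sym x y : seq_dist x y = seq_dist y x.
Proof.
suff le x' y' : seq_dist x' y' <= seq_dist y' x' by apply/le_anti; rewrite !le.
apply: seq_dist_le => m; rewrite /wdiff distrC; exact: wdiff_le_dist.
Qed.

Lemma seq_dist_eq0 x y : seq_dist x y = 0 -> x = y.
Proof.
move=> xy0; apply: tame_seq_eq => m; apply/eqP; rewrite -subr_eq0 -normr_le0.
have := wdiff_le_dist x y m; rewrite xy0 ler_pdivrMr ?exprn_gt0//.
by rewrite mul0r.
Qed.

Lemma seq_dist_triangle y x z : seq_dist x z <= seq_dist x y + seq_dist y z.
Proof.
apply: seq_dist_le => m.
apply: le_trans (lerD (wdiff_le_dist x y m) (wdiff_le_dist y z m)).
by rewrite -mulrDl ler_wpM2r ?invr_ge0 ?exprn_ge0// ler_distD.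
Qed.

HB.instance Definition _ := @isMetric.Build R X seq_dist seq_dist_xx
  seq_dist_eq0 seq_dist_sym seq_dist_triangle.

Definition const_seq (c : R) (c01 : 0 <= c <= 1) : X := TameSeq (tame_cst c01).

Lemma zero01 : 0 <= (0 : R) <= 1. Proof. by rewrite lexx ler01. Qed.
Lemma one01 : 0 <= (1 : R) <= 1. Proof. by rewrite lexx ler01. Qed.

HB.instance Definition _ := isPointed.Build X (const_seq zero01).

End tame_space.

(** * Filters and metric spaces *)

Lemma ultra_fmap (T U : Type) (f : T -> U) (F : set_system T) :
  UltraFilter F -> UltraFilter (f @ F).
Proof.
move=> FU; split; first exact: fmap_proper_filter.
move=> G GF FG; apply/seteqP; split=> A; last exact: FG.
move=> GA; have [//|FCA] := in_ultra_setVsetC (f @^-1` A) FU.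
have GCA : G (~` A) by exact: FG.
by have [u [Au]] := filter_ex (filterI GA GCA).
Qed.

Section metric_filters.
Context {R : realType} {M : metricType R}.

Lemma cvg_mdist (F : set_system M) (l : M) : Filter F ->
  (forall e : R, 0 < e -> \forall x \near F, mdist l x <= e) -> F --> l.
Proof.
move=> FF Fl; apply/cvg_ballP => e e0.
have /Fl : 0 < e / 2 by rewrite divr_gt0.
apply: filterS => x le_e; rewrite ballEmdist/=; apply: le_lt_trans le_e _.
by rewrite ltr_pdivrMr// ltr_pMr// ltr1n.
Qed.

Lemma lipschitz_continuous (k : R) (f : M -> M) : 0 < k ->
  (forall x y, mdist (f x) (f y) <= k * mdist x y) -> continuous f.
Proof.
move=> k0 fk x; apply/cvg_ballP => e e0; apply/nbhs_ballP; exists (e / k) => /=.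
  by rewrite divr_gt0.
move=> y; rewrite !ballEmdist/= ltr_pdivlMr// mulrC.
exact: le_lt_trans (fk _ _).
Qed.

Lemma open_mdist (U : set M) x : open U -> U x ->
  exists2 e : R, 0 < e & forall y, mdist x y <= e -> U y.
Proof.
move=> oU Ux; have /nbhs_ballP[e /= e0 eU] := open_nbhs_nbhs (conj oU Ux).
exists (e / 2); first by rewrite divr_gt0.
move=> y xy; apply: eU; rewrite ballEmdist/=; apply: le_lt_trans xy _.
by rewrite ltr_pdivrMr// ltr_pMr// ltr1n.
Qed.

End metric_filters.

(** * The shift and the compactness of the space *)

Section shift.
Context {R : realType}.
Local Notation X := (tame_seq R).
Implicit Types x y z : X.

Lemma mdistE x y : mdist x y = seq_dist x y. Proof. by []. Qed.

Lemma head_dist x y : `|x 0%N - y 0%N| <= mdist x y.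
Proof. by apply: le_trans (wdiff_le_dist x y 0); rewrite /wdiff expr0 divr1. Qed.

(** The growth bound turns the weighted supremum into its term at time 0. *)
Lemma dist_le_head x y : mdist x y <= x 0%N + y 0%N.
Proof.
apply: seq_dist_le => m; rewrite ler_pdivrMr ?exprn_gt0// mulrC mulrDr.
have := tame_growth m (tame_seqP x); have := tame_growth m (tame_seqP y).
have := seq_ge0 x m; have := seq_ge0 y m; rewrite ler_norml; lra.
Qed.

(** The coordinates from n on contribute at most 3 ^ - n, as all values lie in
[0, 1]. *)
Lemma dist_le_agree x y n (e : R) : 0 <= e -> 3 ^- n <= e ->
  (forall i, (i < n)%N -> `|x i - y i| <= e) -> mdist x y <= e.
Proof.
move=> e0 ne xy; apply: seq_dist_le => m.
have m0 : 0 < 3 ^+ m :> R by rewrite exprn_gt0.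
have m1 : 1 <= 3 ^+ m :> R by rewrite exprn_ege1// ler1n.
have [/xy le_e|le_nm] := ltnP m n.
  by rewrite ler_pdivrMr// (le_trans le_e)// ler_peMr.
apply: le_trans ne; rewrite -[leRHS]mul1r ler_pM ?invr_ge0 ?(ltW m0)//.
  by have := seq01 x m; have := seq01 y m; rewrite ler_norml; lra.
by rewrite lef_pV2 ?posrE ?exprn_gt0// ler_weXn2l// ler1n.
Qed.

Lemma pow3_small (e : R) : 0 < e -> exists2 n, (0 < n)%N & 3 ^- n <= e.
Proof.
move=> e0; exists (Num.truncn e^-1).+1 => //.
rewrite -[leRHS]invrK lef_pV2 ?posrE ?exprn_gt0 ?invr_gt0//.
apply: le_trans (ltW (truncnS_gt e^-1)) _; move: (_.+1) => k.
by rewrite -natrX ler_nat ltnW// ltn_expl.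
Qed.

Definition shift x : X := TameSeq (tame_shift 1 (tame_seqP x)).

Lemma iter_shiftE n x i : iter n shift x i = x (n + i)%N.
Proof. by elim: n i => [//|n IH] i; rewrite /= IH addnCA. Qed.

Lemma shift_lip x y : mdist (shift x) (shift y) <= 3 * mdist x y.
Proof.
apply: seq_dist_le => m; have := wdiff_le_dist x y m.+1.
rewrite -mdistE /wdiff/= exprS invfM mulrCA -ler_pdivlMl ?invr_gt0// invrK.
by rewrite add1n.
Qed.

Lemma continuous_shift : continuous shift.
Proof.
by apply: (@lipschitz_continuous _ X 3) => // x y; exact: shift_lip.
Qed.

(** Along an ultrafilter every coordinate converges in [0, 1]; the limit
sequence satisfies the constraints because each involves finitely many
coordinates. *)
Lemma compact_tame : compact [set: X].
Proof.
rewrite compact_ultra => F FU _.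
have coord i : exists2 l : R, 0 <= l <= 1 & (fun x : X => x i) @ F --> l.
  have := @segment_compact R 0 1; rewrite compact_ultra.
  move=> /(_ _ (ultra_fmap (fun x : X => x i) FU))[].
    rewrite /fmap/=; apply: (@filterS _ F _ setT) filterT => x _ /=.
    by rewrite in_itv/=; exact: seq01.
  by move=> l [/= l01 Fl]; exists l => //; move: l01; rewrite in_itv.
have [l lP] := choice (fun i => (exists2P _ _).1 (coord i)).
have l01 i := (lP i).1; have Fl i := (lP i).2.
have tl : tame l.
  split=> [//|i n].
  have sumF : (\sum_(j < n) x (i + j)%N) @[x --> F] -->
      \sum_(j < n) l (i + j)%N.
    by apply: cvg_big => [|j _]; [exact: add_continuous | exact: Fl].
  have headF : (2 * n%:R * x i) @[x --> F] --> 2 * n%:R * l i.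
    by apply: cvgM; [exact: cvg_cst | exact: Fl].
  apply: ler_cvg_to sumF headF _.
  by apply: nearW => x; case: (tame_seqP x).
exists (TameSeq tl); split => //=.
apply: (@cvg_mdist _ X) => e e0; have [n _ ne] := pow3_small e0.
have Fn : F [set x : X | forall i : 'I_n, `|l i - x i| <= e].
  by apply: filter_forall => i; move/cvgrPdist_le : (Fl i); apply.
apply: filterS Fn => x lx; apply: (dist_le_agree (n := n)) => // [|i lt_in].
  exact: ltW.
exact: (lx (Ordinal lt_in)).
Qed.

End shift.

(** * Mean distance along orbits *)

Section mean_distance.
Context {R : realType} {M : pmetricType R}.
Implicit Types (T : M -> M) (x y : M).

Lemma mean_dist_le T x y (c : R) : 0 <= c ->
  (forall n, \sum_(i < n) mdist (iter i T x) (iter i T y) <= n%:R * c) ->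
  (mean_dist T x y <= c%:E)%E.
Proof.
move=> c0 le_c; rewrite /mean_dist limn_esup_lim.
apply: lime_le; first exact: is_cvg_esups.
apply: nearW => k; apply: ge_ereal_sup => _ [n _ <-]; rewrite lee_fin.
have [->|n0] := posnP n; first by rewrite big_ord0 mulr0.
by rewrite ler_pdivrMl ?ltr0n.
Qed.

(** The averages over the first n > 2 m times reach c / 2, since at least half of
their terms are at least c; this avoids computing their limit. *)
Lemma mean_dist_ge T x y (c : R) m : 0 <= c ->
  (forall i, (m <= i)%N -> c <= mdist (iter i T x) (iter i T y)) ->
  ((c / 2)%:E <= mean_dist T x y)%E.
Proof.
move=> c0 ge_c; rewrite /mean_dist limn_esup_lim.
apply: lime_ge; first exact: is_cvg_esups.
apply: nearW => k; pose n := (m + m + k).+1.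
apply: (@le_trans _ _ ((n%:R^-1 * \sum_(i < n)
    mdist (iter i T x) (iter i T y))%:E)%E); last first.
  by apply: ereal_sup_ubound; exists n => //=; rewrite /n; lia.
rewrite lee_fin ler_pdivlMl ?ltr0n//.
apply: (@le_trans _ _ (\sum_(m <= i < n) c)).
  rewrite big_const_nat iter_addr_0 -[c *+ _]mulr_natl.
  have : n%:R <= 2 * (n - m)%:R :> R by rewrite -natrM ler_nat /n; lia.
  nra.
rewrite -(big_mkord predT (fun i => mdist (iter i T x) (iter i T y))).
rewrite [leRHS](@big_cat_nat _ _ _ m)//=; last by rewrite /n; lia.
apply: ler_wpDl; first by apply: sumr_ge0 => i _; exact: mdist_ge0.
by apply: ler_sum_nat => i /andP[mi _]; exact: ge_c.
Qed.

End mean_distance.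

(** * Sensitivity, equicontinuity and transitivity of the shift *)

Section dynamics_of_shift.
Context {R : realType}.
Local Notation X := (tame_seq R).
Implicit Types x y z : X.

Lemma mean_dist_le_head x y :
  (mean_dist (@shift R : X -> X) x y <= (2 * (x 0%N + y 0%N))%:E)%E.
Proof.
apply: (@mean_dist_le _ X) => [|n].
  by rewrite mulr_ge0// addr_ge0// seq_ge0.
apply: (@le_trans _ _ (\sum_(i < n) (x (0 + i)%N + y (0 + i)%N))).
  apply: ler_sum => i _; apply: le_trans (dist_le_head _ _) _.
  by rewrite !iter_shiftE !addn0 !add0n.
rewrite big_split/=.
have := (tame_seqP x).2 0%N n; have := (tame_seqP y).2 0%N n; lra.
Qed.

Lemma open_head_lt (c : R) : open [set x : X | x 0%N < c].
Proof.
rewrite openE => x /= xc; apply/nbhs_ballP; exists (c - x 0%N) => /=.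
  by rewrite subr_gt0.
move=> y; rewrite ballEmdist/= => /(le_lt_trans (head_dist x y)).
rewrite ltr_norml; lra.
Qed.

Lemma shift_not_mean_sensitive : ~ mean_sensitive (@shift R : X -> X).
Proof.
move=> [d d0 /(_ [set x : X | x 0%N < d / 4])].
move=> /(_ (@open_head_lt _))[].
  by exists (const_seq zero01); rewrite /= divr_gt0.
move=> x [y [/= xd yd]]; apply/negP; rewrite -leNgt.
apply: le_trans (mean_dist_le_head x y) _; rewrite lee_fin; lra.
Qed.

Lemma shift_not_mean_equicontinuous :
  ~ mean_equicontinuous (@shift R : X -> X).
Proof.
pose one : X := const_seq one01.
move=> /(_ one (1 / 2)); rewrite divr_gt0// => /(_ isT)[d d0 near_one].
have [n n0 nd] := pow3_small (divr_gt0 d0 (ltr0n R 2)).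
have zero_le1 i : (i < n)%N -> (0 : R) <= 1 by rewrite ler01.
(* the sequence with n values 1 followed by 0 *)
pose y : X := TameSeq (tame_glue (tame_cst one01) (tame_cst zero01) zero_le1).
have /near_one : mdist one y < d.
  apply: (@le_lt_trans _ _ (d / 2)); last by rewrite ltr_pdivrMr// ltr_pMr// ltr1n.
  apply: (dist_le_agree (n := n)) => // [|i lt_in]; first by rewrite divr_ge0 ?ltW.
  by rewrite /= /glue lt_in subrr normr0 divr_ge0 ?ltW.
apply/negP; rewrite -leNgt; apply: (@mean_dist_ge _ X _ _ _ _ n) => // i ni.
apply: le_trans (head_dist _ _); rewrite !iter_shiftE addn0/= /glue ltnNge ni/=.
by rewrite subr0 normr1.
Qed.

Lemma contract_near x (e : R) : 0 < e ->
  exists2 h : R, 0 < h & exists2 y, mdist x y <= e & forall i, h <= y i.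
Proof.
move=> e0; pose h := Num.min e 1.
have h0 : 0 < h by rewrite lt_min e0/=.
have h01 : 0 <= h <= 1 by rewrite (ltW h0)/= ge_min lexx orbT.
exists h => //; exists (TameSeq (tame_contract h01 (tame_seqP x))); last first.
  move=> i /=; have /andP[_ h1] := h01.
  by rewrite lerDr mulr_ge0 ?seq_ge0// subr_ge0.
have [n _ ne] := pow3_small e0.
apply: (dist_le_agree (n := n)) => // [|i _]; first exact: ltW.
rewrite /= (_ : x i - _ = h * (x i - 1)); last by ring.
rewrite normrM ger0_norm ?(ltW h0)//.
apply: (@le_trans _ _ h); last by rewrite ge_min lexx.
rewrite -[leRHS]mulr1 ler_wpM2l ?(ltW h0)//.
by have := seq01 x i; rewrite ler_norml; lra.
Qed.

Lemma dist_le_split x y z (e : R) n : 0 <= e -> 3 ^- n <= e / 2 ->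
  mdist x y <= e / 2 -> (forall i, (i < n)%N -> z i = y i) -> mdist x z <= e.
Proof.
move=> e0 ne xy yz; apply: le_trans (seq_dist_triangle y x z) _.
rewrite [e]splitr lerD//; apply: (dist_le_agree (n := n)) => //.
  by rewrite divr_ge0.
by move=> i /yz ->; rewrite subrr normr0 divr_ge0.
Qed.

Lemma periodic_dense x (e : R) : 0 < e ->
  exists p P, [/\ (0 < P)%N, iter P (@shift R) p = p & mdist x p <= e].
Proof.
move=> e0; have e20 : 0 < e / 2 by rewrite divr_gt0.
have [h h0 [y xy hy]] := contract_near x e20.
have [n n0 ne] := pow3_small e20.
have [m [b [tb _ bmin by_]]] := ladder n0 h0 (tame_seqP y) (fun i _ => hy i).
have P0 : (0 < m + n)%N by rewrite addn_gt0 n0 orbT.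
exists (iter m (@shift R) (TameSeq (tame_periodic P0 tb bmin))), (m + n)%N.
split=> //.
  apply: tame_seq_eq => i; rewrite !iter_shiftE/=.
  by congr b; rewrite addnCA modnDl.
apply: (dist_le_split (ltW e0) ne xy) => i lt_in.
by rewrite iter_shiftE/= modn_small ?ltn_add2l// by_.
Qed.

(** The connecting point reads a word of U, then a ladder leading to a word of
V. *)
Lemma shift_transitive : transitive_system (@shift R : X -> X).
Proof.
move=> U V oU [x Ux] oV [z Vz].
have [e e0 eU] := @open_mdist R X U x oU Ux.
have [e' e'0 eV] := @open_mdist R X V z oV Vz.
have e20 : 0 < e / 2 by rewrite divr_gt0.
have e'20 : 0 < e' / 2 by rewrite divr_gt0.
have [h h0 [y xy hy]] := contract_near x e20.
have [h' h'0 [u zu hu]] := contract_near z e'20.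
have [n n0 ne] := pow3_small e20.
have [n' n'0 ne'] := pow3_small e'20.
have k0 : 0 < Num.min h h' by rewrite lt_min h0.
have ku i : (i < n')%N -> Num.min h h' <= u i.
  by move=> _; rewrite ge_min hu orbT.
have [m [b [tb b0 _ bu]]] := ladder n'0 k0 (tame_seqP u) ku.
have by0 i : (i < n)%N -> b 0%N <= y i.
  by move=> _; apply: le_trans b0 _; rewrite ge_min hy.
pose w : X := TameSeq (tame_glue (tame_seqP y) tb by0).
exists (n + m)%N; split; first by rewrite addn_gt0 n0.
exists (iter (n + m) (@shift R) w); split.
  exists w => //; apply: eU; apply: (dist_le_split (ltW e0) ne xy) => i lt_in.
  by rewrite /= /glue lt_in.
apply: eV; apply: (dist_le_split (ltW e'0) ne' zu) => i lt_in.
by rewrite iter_shiftE/= /glue -addnA ltnNge leq_addr/= addKn bu.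
Qed.

End dynamics_of_shift.

(** * Invariant measures carried by periodic orbits *)

Section periodic_measure.
Context {R : realType} {X : pmetricType R} (T : X -> X).
Variables (c : nat -> X) (P : nat -> nat).
Hypothesis P_gt0 : forall k, (0 < P k)%N.
Hypothesis c_periodic : forall k, iter (P k) T (c k) = c k.

Local Open Scope ereal_scope.

Let borelX : measurableType _ := @borel R X.

Definition weight k : {nonneg R} :=
  ((P k)%:R^-1 * (1 / (2 ^ (k + 1))%:R))%:nng%R.

Definition orbit_measure k : {measure set borelX -> \bar R} :=
  mscale (weight k) (msum (fun i => \d_(iter i T (c k) : borelX)) (P k)).

Lemma orbit_measureE k (A : set borelX) : orbit_measure k A =
  (weight k)%:num%:E * \sum_(i < P k) (\1_A (iter i T (c k)))%:E.
Proof. by []. Qed.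

(** Taking the preimage shifts the sum over the orbit by one step, and the
period closes the cycle. *)
Lemma orbit_measure_preim k (A : set borelX) :
  orbit_measure k (T @^-1` A) = orbit_measure k A.
Proof.
rewrite !orbit_measureE; congr (_ * _); have := P_gt0 k.
have := c_periodic k; case: (P k) => // p cp _.
rewrite (eq_bigr (fun i : 'I_p.+1 => (\1_A (iter i.+1 T (c k)))%:E)) => [|//].
by rewrite big_ord_recr [RHS]big_ord_recl cp addeC.
Qed.

Lemma orbit_measure_setT k :
  orbit_measure k [set: borelX] = (1 / (2 ^ (k + 1))%:R)%:E.
Proof.
rewrite orbit_measureE (eq_bigr (fun=> 1)) => [|i _]; last by rewrite indicT.
rewrite sumEFin -EFinM sumr_const card_ord/= mulrAC mulVf ?mul1r//.
by rewrite pnatr_eq0 -lt0n.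
Qed.

Definition dyadic_mixture : set borelX -> \bar R :=
  mseries orbit_measure 0.

HB.instance Definition _ := Measure.on dyadic_mixture.

Lemma dyadic_mixture_setT : dyadic_mixture [set: borelX] = 1.
Proof.
have half : (series (fun k => 1 / (2 ^ (k + 1))%:R : R^o) @ \oo --> (1 : R^o))%R.
  by have := @cvg_geometric_series_half R 1 0; rewrite expr0 divr1.
rewrite /dyadic_mixture/= /mseries.
rewrite (eq_eseriesr (fun k _ => orbit_measure_setT k)).
apply: cvg_lim => //.
rewrite (_ : (fun n => _) = EFin \o series (fun k => 1 / (2 ^ (k + 1))%:R : R)%R).
  by apply: cvg_EFin; [exact: nearW | exact: half].
by apply/funext => n; rewrite /= sumEFin.
Qed.

HB.instance Definition _ :=
  Measure_isProbability.Build _ _ _ dyadic_mixture dyadic_mixture_setT.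

Lemma dyadic_mixture_invariant :
  invariant_measure T (dyadic_mixture : probability borelX R).
Proof.
move=> A _; apply: eq_eseriesr => k _; exact: orbit_measure_preim.
Qed.

Lemma dyadic_mixture_full_support :
  (forall U : set X, open U -> U !=set0 -> exists k, U (c k)) ->
  full_support (dyadic_mixture : probability borelX R).
Proof.
move=> dense; apply/seteqP; split=> // x _ U oU Ux.
have [k Uk] := dense U oU (ex_intro _ x Ux).
apply: (@lt_le_trans _ _ (orbit_measure k U)).
  rewrite orbit_measureE mule_gt0// ?lte_fin//.
    by rewrite /= mulr_gt0 ?divr_gt0 ?invr_gt0 ?ltr0n ?expn_gt0 ?P_gt0//.
  have := P_gt0 k; case: (P k) => // p _; rewrite big_ord_recl/=.
  rewrite indicE mem_set//; apply: (@lt_le_trans _ _ 1); first exact: lte01.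
  by rewrite leeDl// sume_ge0.
have ge0 i : 0 <= orbit_measure i U by exact: measure_ge0.
apply: le_trans (nneseries_lim_ge k.+1 (fun i _ _ => ge0 i)).
by rewrite big_nat_recr//= leeDr// sume_ge0.
Qed.

Lemma periodic_sequence_measure :
  (forall U : set X, open U -> U !=set0 -> exists k, U (c k)) ->
  exists mu : probability borelX R,
    invariant_measure T mu /\ full_support mu.
Proof.
move=> dense; exists (dyadic_mixture : probability borelX R); split.
  exact: dyadic_mixture_invariant.
exact: dyadic_mixture_full_support.
Qed.

End periodic_measure.

(** Compactness yields a countable basis, hence countably many periodic points
that meet every non-empty open set. *)
Lemma periodic_full_support_measure {R : realType} {X : pmetricType R}
    (T : X -> X) : compact [set: X] ->
  (forall U : set X, open U -> U !=set0 ->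
    exists p P, [/\ (0 < P)%N, iter P T p = p & U p]) ->
  exists mu : probability (@borel R X) R,
    invariant_measure T mu /\ full_support mu.
Proof.
move=> cX dense.
have [B cB [oB bB]] := @compact_second_countable R X cX.
have [p0 [P0 [P0_gt0 p0P _]]] := dense setT openT (ex_intro _ point I).
have [f fB] : exists f : nat -> set X, B `<=` range f.
  have /pfcard_geP[->|[g]] := cB; first by exists (fun=> setT).
  by exists g; exact: surj.
have /choice[q qP] : forall k, exists q : X * nat, [/\ (0 < q.2)%N,
    iter q.2 T q.1 = q.1 & open (f k) -> f k !=set0 -> f k q.1].
  move=> k; have [[ofk fk0]|nfk] := pselect (open (f k) /\ f k !=set0).
    by have [p [P [? ? ?]]] := dense _ ofk fk0; exists (p, P).
  by exists (p0, P0); split => // ? ?; case: nfk.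
pose c k := (q k).1; pose P k := (q k).2.
have P_gt0 k : (0 < P k)%N by case: (qP k).
have cP k : iter (P k) T (c k) = c k by case: (qP k).
apply: (periodic_sequence_measure P_gt0 cP) => U oU [x Ux].
have [V [BV Vx] VU] := bB x U (open_nbhs_nbhs (conj oU Ux)).
have [k _ fk] := fB V BV; exists k; apply: VU; rewrite -fk.
have [_ _] := qP k; apply; rewrite fk; first exact: oB.
by exists x.
Qed.

(** * An E-system on neither side of the dichotomy *)

Theorem corollary1p6 (R : realType) :
  exists (X : pmetricType R) (T : X -> X),
    [/\ E_system T, ~ mean_sensitive T & ~ mean_equicontinuous T].
Proof.
exists (tame_seq R : pmetricType R), (@shift R); split.
- split; first by split; [exact: compact_tame | exact: continuous_shift].
    exact: shift_transitive.
  apply: periodic_full_support_measure; first exact: compact_tame.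
  move=> U oU [x Ux].
  have [e e0 eU] := @open_mdist R (tame_seq R) U x oU Ux.
  have [p [P [P0 pP xp]]] := periodic_dense x e0.
  by exists p, P; split=> //; exact: eU.
- exact: shift_not_mean_sensitive.
- exact: shift_not_mean_equicontinuous.
Qed.
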